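(* Let $(\underline F,\overline F)$ be a p-box on a totally preordered space $(\Omega,\preceq)$ with smallest element $0_\Omega$ and largest element $1_\Omega$. If its natural extension $\overline E_{\underline F,\overline F}$ is maximum preserving, i.e. $\overline E_{\underline F,\overline F}(A\cup B)=\max\{\overline E_{\underline F,\overline F}(A),\overline E_{\underline F,\overline F}(B)\}$ for all $A,B\subseteq\Omega$, then at least one of $\underline F$ or $\overline F$ is $0$–$1$-valued.
   Context: A total preorder $\preceq$ is reflexive, transitive, with any two elements comparable. A cumulative distribution function is a non-decreasing map $F:\Omega\to[0,1]$ with $F(1_\Omega)=1$ (no continuity is required). A p-box is a pair $(\underline F,\overline F)$ of cumulative distribution functions with $\underline F\le\overline F$. $F$ is $0$–$1$-valued if it takes only the values $0$ and $1$. The natural extension of the p-box is $\overline E_{\underline F,\overline F}(A)=\sup P(A)$ for $A\subseteq\Omega$, the supremum being over all finitely additive probabilities $P$ on the power set of $\Omega$ with $\underline F(x)\le P([0_\Omega,x])\le\overline F(x)$ for all $x\in\Omega$, where $[0_\Omega,x]=\{z\in\Omega: z\preceq x\}$. *)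

(* Defs.v *)
From mathcomp Require Import all_boot all_order all_algebra.
From mathcomp Require Import all_classical all_reals.

Set Implicit Arguments.
Unset Strict Implicit.
Unset Printing Implicit Defensive.

Import Order.TTheory GRing.Theory Num.Theory.
Local Open Scope classical_set_scope.
Local Open Scope ring_scope.

(* A totally preordered space with smallest element 0_Omega and largest element
   1_Omega is a [tbPreorderType] whose order relation is [total]; 0_Omega and
   1_Omega are [\bot] and [\top]. Antisymmetry is not assumed. *)

Section PBox.
Context {R : realType} {d : Order.disp_t} {Omega : tbPreorderType d}.
Implicit Types (F Fl Fu : Omega -> R) (P E : set Omega -> R).

Definition is_cdf F : Prop :=
  [/\ {homo F : x y / (x <= y)%O},
      forall x, 0 <= F x <= 1
    & F \top%O = 1].

Definition is_pbox Fl Fu : Prop :=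
  [/\ is_cdf Fl, is_cdf Fu & forall x, Fl x <= Fu x].

Definition zero_one_valued F : Prop := forall x, F x = 0 \/ F x = 1.

Definition fin_additive_probability P : Prop :=
  [/\ forall A, 0 <= P A,
      P setT = 1
    & forall A B, A `&` B = set0 -> P (A `|` B) = P A + P B].

(* Intervals [a, b] are only available in the library for partial orders,
   hence the comprehension; it contains every element equivalent to x. *)
Definition initial_segment (x : Omega) : set Omega :=
  [set z | (z <= x)%O].

Definition credal_set Fl Fu : set (set Omega -> R) :=
  [set P | fin_additive_probability P /\
           forall x, Fl x <= P (initial_segment x) <= Fu x].

(* When <= is total, the credal set of a p-box is nonempty; as 0 <= P A <= 1, this is
   a genuine supremum and the default value of [sup] is never used. *)
Definition natural_extension Fl Fu : set Omega -> R :=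
  fun A => sup [set P A | P in credal_set Fl Fu].

Definition maximum_preserving E : Prop :=
  forall A B, E (A `|` B) = Num.max (E A) (E B).

End PBox.

(* Main.v *)
(* If F is a distribution function, then for each t the set function z |-> [t <= F z]
   is the distribution function of an ultrafilter U_t, and the uniform mixture of the
   U_t over t in (0, 1] has distribution function F; to avoid measurability, the
   mixture is taken as an ultrafilter limit of averages over the grids k / n. So every
   distribution function between Fl and Fu comes from an element of the credal set.

   Suppose 0 < Fl x < 1 and 0 < Fu y < 1. The upper probabilities of [0, x] and of its
   complement are at most Fu x and 1 - Fl x < 1, so maximum preservation forces
   Fu x = 1, hence y <= x. Mass at [0, y] and at the complement of [0, x] can then be
   attained simultaneously by the distribution function that is Fu up to y and
   max(Fl, Fu y) afterwards; it gives their union probability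
   min(1, 1 - Fl x + Fu y), exceeding both upper probabilities Fu y and 1 - Fl x. *)
Require Import Defs.
From mathcomp Require Import all_boot all_order all_algebra.
From mathcomp Require Import all_classical all_reals.
From mathcomp Require Import topology normedtype sequences.
From mathcomp Require Import lra.

Set Implicit Arguments.
Unset Strict Implicit.
Unset Printing Implicit Defensive.

Import Order.TTheory GRing.Theory Num.Theory.
Import numFieldNormedType.Exports.
Local Open Scope classical_set_scope.
Local Open Scope ring_scope.

(** An ultrafilter contains [A] or its complement, but never two disjoint sets. Hence its 0-1
    indicator is a finitely additive probability. *)
Lemma ultrafilter_setU_disjoint (T : Type) (U : set_system T) (A B : set T) :
  UltraFilter U -> A `&` B = set0 ->
  `[< U (A `|` B) >] = (`[< U A >] + `[< U B >])%N :> nat.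
Proof.
move=> UU AB0.
have UP : ProperFilter U := @ultra_proper _ _ UU.
have nU0 : ~ U set0 by exact: filter_not_empty.
have [UA|UnA] := in_ultra_setVsetC A UU.
  rewrite (asboolT UA) (asboolT (filterS (@subsetUl _ A B) UA)) asboolF// => UB.
  by apply: nU0; rewrite -AB0; exact: filterI.
rewrite [`[< U A >]]asboolF => [|UA]; last first.
  by apply: nU0; rewrite -(setICr A); exact: filterI.
rewrite add0n; congr nat_of_bool; apply/asbool_equiv_eq; split => [UAB|].
  by apply: filterS (filterI UnA UAB) => z [nAz [|]].
by apply: filterS; exact: subsetUr.
Qed.

(** Compactness of [[a, b]] gives a cluster point of the image of [U], and an ultrafilter converges
    to each of its cluster points. *)
Lemma ultrafilter_bounded_cvg (R : realType) (I : Type) (U : set_system I)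
    (a b : R) (u : I -> R) :
  UltraFilter U -> (forall i, a <= u i <= b) ->
  exists2 l, a <= l <= b & u @ U --> l.
Proof.
move=> UU uab.
have UP : ProperFilter U := @ultra_proper _ _ UU.
have FI : (u @ U) `[a, b]%classic.
  by apply: (@filterE _ U) => i; rewrite /= in_itv /= uab.
have [l [/= + Cl]] := @segment_compact R a b (u @ U) _ FI.
rewrite in_itv /= => lab; exists l => // V Vl.
have [//|UnV] := in_ultra_setVsetC (u @^-1` V) UU.
by have [z []] := Cl (~` V) V UnV Vl.
Qed.

(** The grid points below [c] are the first ones, up to index the floor of [m.+1 * c]; as [c <= 1],
    this floor does not run past the grid. *)
Lemma card_uniform_grid (R : realType) (c : R) (m : nat) : 0 <= c <= 1 ->
  (\sum_(k < m.+1) (k.+1%:R / m.+1%:R <= c)%R)%N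
    = Num.truncn (m.+1%:R * c).
Proof.
move=> /andP[c0 c1]; set t := Num.truncn _.
have mc0 : 0 <= m.+1%:R * c by rewrite mulr_ge0.
have tm : (t <= m.+1)%N.
  by rewrite -(ler_nat R) (le_trans (_ : _ <= m.+1%:R * c))
     ?truncn_le ?ler_piMr.
have E (k : 'I_m.+1) : (k.+1%:R / m.+1%:R <= c) = (k < t)%N.
  by rewrite truncn_gt_nat ler_pdivrMr ?ltr0n// mulrC.
under eq_bigr do rewrite E.
rewrite -(big_mkord xpredT (fun k => nat_of_bool (k < t)%N)).
rewrite (big_cat_nat (n := t))//= big_nat.
rewrite (eq_bigr (fun=> 1%N)) => [|k /andP[_ ->]//].
rewrite -big_nat sum_nat_const_nat subn0 muln1 big_nat big1 ?addn0// => k.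
by move=> /andP[tk _]; rewrite ltnNge tk.
Qed.

Lemma interior01 (R : numDomainType) (a : R) :
  0 <= a <= 1 -> a <> 0 -> a <> 1 -> 0 < a < 1.
Proof.
by move=> /andP[a0 a1] /eqP an0 /eqP an1; rewrite !lt_neqAle a0 a1 eq_sym an0 an1.
Qed.

Section NaturalExtension.
Context {R : realType} {d : Order.disp_t} {Omega : tbPreorderType d}.
Variable le_total : total (@Order.le d Omega).
Implicit Types F Fl Fu : Omega -> R.

(* The ultrafilter sits at the lower end of the level set [t <= F], i.e. it is
   the 0-1-valued probability whose distribution function is [t <= F]. *)
Lemma level_ultrafilter F t : is_cdf F -> t <= 1 ->
  exists2 U : set_system Omega, UltraFilter U &
    forall x, U (initial_segment x) <-> t <= F x.
Proof.
move=> [Fmono _ F1] t1.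
pose B z : set Omega := [set v | (v <= z)%O /\ t <= F v].
pose G := filter_from [set z | t <= F z] B.
have FG : Filter G.
  (* The base is directed: of two comparable points, the smaller one gives a base set contained in
     both. *)
  apply: filter_from_filter => [|z w tz tw]; first by exists \top%O; rewrite /= F1.
  by have /orP[zw|wz] := le_total z w; [exists z|exists w] => // v [vx tv];
    do 2![split=> //]; apply: le_trans vx _.
have PG : ProperFilter G.
  by apply: filter_from_proper => z tz; exists z.
have [U [UU GU]] := ultraFilterLemma PG.
have UP : ProperFilter U := @ultra_proper _ _ UU.
exists U => // x; split => [Ux|tx]; last by apply: GU; exists x => // v [].
(* The level set is itself in [U], so it meets the initial segment of [x]; monotonicity carries
   [t <= F v] up to [x]. *)
have : U [set v | t <= F v] by apply: GU; exists \top%O; rewrite /= ?F1// => v [].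
move=> /(filterI Ux)/filter_ex[v [vx /= tv]].
by apply: le_trans tv _; exact: Fmono.
Qed.

Lemma cdf_extension F : is_cdf F ->
  exists2 P, fin_additive_probability P & forall x, P (initial_segment x) = F x.
Proof.
move=> cdfF; have [Fmono F01 F1] := cdfF.
(* Nothing is asked of [V] at levels above 1, which are never grid levels. *)
have /choice[V VP] (t : R) : exists U : set_system Omega, t <= 1 ->
    UltraFilter U /\ forall x, U (initial_segment x) <-> t <= F x.
  have [t1|t1] := leP t 1; last by exists set0.
  by have [U UU UF] := level_ultrafilter cdfF t1; exists U.
have grid1 n (k : 'I_n.+1) : k.+1%:R / n.+1%:R <= 1 :> R.
  by rewrite ler_pdivrMr ?ltr0n// mul1r ler_nat.
(* Starting at [k.+1] keeps level 0 off the grid: it would be counted even where [F] vanishes. *)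
pose S n A := (\sum_(k < n.+1) `[< V (k.+1%:R / n.+1%:R) A >])%N.
pose avg A n : R := (S n A)%:R / n.+1%:R.
have avg01 A n : 0 <= avg A n <= 1.
  rewrite divr_ge0//= ler_pdivrMr ?ltr0n// mul1r ler_nat.
  rewrite -[leqRHS](card_ord n.+1) -sum1_card leq_sum// => k _.
  by case: asbool.
have [U [UU ooU]] := ultraFilterLemma (eventually_filter).
have UP : ProperFilter U := @ultra_proper _ _ UU.
have /choice[P PP] A : exists l : R, 0 <= l <= 1 /\ avg A @ U --> l.
  by have [l l01 Ul] := ultrafilter_bounded_cvg UU (avg01 A); exists l.
have Plim A (l : R) : avg A @ U --> l -> P A = l.
  move=> Al; have [_ AP] := PP A; exact: norm_cvg_unique AP Al.
have Pini x : P (initial_segment x) = F x.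
  apply: Plim; apply: cvg_trans (_ : avg (initial_segment x) @ \oo --> _).
    by move=> W; exact: ooU.
  set c := F x; have c01 : 0 <= c <= 1 by exact: F01.
  have mc0 n : 0 <= n.+1%:R * c by rewrite mulr_ge0//; case/andP: c01.
  have avgE n :
      avg (initial_segment x) n = (Num.truncn (n.+1%:R * c))%:R / n.+1%:R.
    rewrite /avg -card_uniform_grid//; congr (_%:R / _); apply: eq_bigr => k _.
    have [_ VF] := VP _ (grid1 n k).
    by congr nat_of_bool; apply/asboolP/idP => /VF.
  apply: (@squeeze_cvgr _ _ _ _ (fun n => c - harmonic n) (fun=> c)).
  - apply: nearW => n; rewrite avgE; have /andP[ge lt] := truncn_itv (mc0 n).
    rewrite ler_pdivrMr ?ltr0n// [c * _]mulrC ge andbT ler_pdivlMr ?ltr0n//.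
    rewrite mulrBl /harmonic mulVf ?pnatr_eq0// mulrC lerBlDr natr1.
    exact: ltW.
  - rewrite -[X in _ --> X]subr0.
    by apply: cvgB; [exact: cvg_cst|exact: cvg_harmonic].
  - exact: cvg_cst.
exists P => //; split => [A||A B AB0].
- by have [/andP[]] := PP A.
- rewrite -F1 -Pini; congr P; apply/seteqP; split => // z _.
  exact: lex1.
- apply: Plim.
  have -> : avg (A `|` B) = avg A \+ avg B.
    apply/funext => n /=; rewrite /avg -mulrDl -natrD -big_split/=.
    congr (_%:R / _); apply: eq_bigr => k _.
    by apply: ultrafilter_setU_disjoint => //; have [] := VP _ (grid1 n k).
  by apply: cvgD; [exact: (PP A).2|exact: (PP B).2].
Qed.

Lemma fin_additive_probability_setC P (A : set Omega) :
  fin_additive_probability (P : set Omega -> R) -> P (~` A) = 1 - P A.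
Proof.
by move=> [_ PT PU]; rewrite -PT -(setUv A) PU ?setICr// addrAC subrr add0r.
Qed.

Lemma fin_additive_probability_le1 P (A : set Omega) :
  fin_additive_probability (P : set Omega -> R) -> P A <= 1.
Proof.
by move=> Pprob; have [P0 _ _] := Pprob;
  rewrite -subr_ge0 -fin_additive_probability_setC.
Qed.

Lemma credal_set_nonempty Fl Fu : is_pbox Fl Fu -> credal_set Fl Fu !=set0.
Proof.
move=> [cl _ lu]; have [P Pprob PF] := cdf_extension cl.
by exists P; split => // x; rewrite PF lexx lu.
Qed.

Lemma natural_extension_le Fl Fu A c : is_pbox Fl Fu ->
  (forall P, credal_set Fl Fu P -> P A <= c) -> natural_extension Fl Fu A <= c.
Proof.
move=> /credal_set_nonempty[P0 CP0] bnd; apply: ge_sup.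
  by exists (P0 A), P0.
by move=> _ [P CP <-]; exact: bnd.
Qed.

Lemma le_natural_extension Fl Fu P A :
  credal_set Fl Fu P -> P A <= natural_extension Fl Fu A.
Proof.
move=> CP; apply: ub_le_sup; last by exists P.
by exists 1 => _ [Q [Qprob _] <-]; exact: fin_additive_probability_le1.
Qed.

Lemma natural_extension_initial_segment Fl Fu x : is_pbox Fl Fu ->
  natural_extension Fl Fu (initial_segment x) <= Fu x.
Proof.
by move=> pbox; apply: natural_extension_le => // P [_ /(_ x)/andP[]].
Qed.

Lemma natural_extension_final_segment Fl Fu x : is_pbox Fl Fu ->
  natural_extension Fl Fu (~` initial_segment x) <= 1 - Fl x.
Proof.
move=> pbox; apply: natural_extension_le => // P [Pprob /(_ x)/andP[lP _]].
by rewrite fin_additive_probability_setC// lerB.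
Qed.

End NaturalExtension.

Theorem proposition6 (R : realType) (d : Order.disp_t)
    (Omega : tbPreorderType d) (le_total : total (@Order.le d Omega))
    (Fl Fu : Omega -> R) (pbox : is_pbox Fl Fu)
    (maxE : maximum_preserving (natural_extension Fl Fu)) :
  zero_one_valued Fl \/ zero_one_valued Fu.
Proof.
have [[lmono l01 l1] [umono u01 u1] lu] := pbox.
have [?|] := pselect (zero_one_valued Fl); first by left.
move=> /existsNP[x /not_orP[lx0 lx1]]; right => y.
apply: contrapT => /not_orP[uy0 uy1].
have /andP[lx_gt0 lx_lt1] := interior01 (l01 x) lx0 lx1.
have /andP[uy_gt0 uy_lt1] := interior01 (u01 y) uy0 uy1.
have Eini z := natural_extension_initial_segment le_total z pbox.
have Efin z := natural_extension_final_segment le_total z pbox.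
have ux1 : Fu x = 1.
  have [P CP] := credal_set_nonempty le_total pbox.
  have := le_natural_extension setT CP; have [[_ -> _] _] := CP.
  rewrite -(setUv (initial_segment x)) maxE le_max => /orP[] h.
    by apply/eqP; rewrite eq_le; have /andP[_ ->] := u01 x;
      exact: le_trans h (Eini x).
  by have := le_trans h (Efin x); lra.
have yx : (y <= x)%O.
  by have /orP[//|/umono] := le_total y x; rewrite ux1 leNgt uy_lt1.
pose F z := if (z <= y)%O then Fu z else Num.max (Fl z) (Fu y).
have FyE : F y = Fu y by rewrite /F lexx.
have FxE : F x = Num.max (Fl x) (Fu y).
  by rewrite /F; case: ifP => // /umono; rewrite ux1 leNgt uy_lt1.
have lF z : Fl z <= F z by rewrite /F; case: ifP => // _; rewrite le_max lexx.
have Fu_ z : F z <= Fu z.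
  rewrite /F; case: ifPn => // zy; rewrite ge_max lu umono//.
  by have /orP[zy'|//] := le_total z y; rewrite zy' in zy.
have cdfF : is_cdf F.
  split => [z w zw|z|].
  - rewrite /F; case: ifPn => zy; case: ifPn => wy.
    + exact: umono.
    + by rewrite le_max (umono _ _ zy) orbT.
    + by rewrite (le_trans zw wy) in zy.
    + by rewrite ge_max !le_max lmono//= lexx orbT.
  - have /andP[l0 _] := l01 z; have /andP[_ u1'] := u01 z.
    by rewrite (le_trans l0 (lF z)) (le_trans (Fu_ z) u1').
  - by apply/eqP; rewrite eq_le -{1}u1 Fu_ -l1 lF.
have [P Pprob PF] := cdf_extension le_total cdfF.
have CP : credal_set Fl Fu P by split => // z; rewrite PF lF Fu_.
have := le_natural_extension (initial_segment y `|` ~` initial_segment x) CP.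
have [_ _ PU] := Pprob; rewrite PU; last first.
  by apply/subsets_disjoint => z /= zy; exact: le_trans zy yx.
rewrite fin_additive_probability_setC// !PF FyE FxE maxE le_max.
by have [_|_] := leP (Fl x) (Fu y) => /orP[] h;
  [have := le_trans h (Eini y)|have := le_trans h (Efin x)
  |have := le_trans h (Eini y)|have := le_trans h (Efin x)]; lra.
Qed.
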